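(* Let $G$ be a connected cubic graph such that the Sylvester graph $S$ admits a $G$-coloring. Then $G$ is isomorphic to $S$.
   Context: Graphs are finite, undirected, without loops, possibly with multiple edges. For a vertex $v$ of a graph $G$, $\partial_G(v)$ denotes the set of edges incident to $v$. For cubic graphs $G$ and $H$, an $H$-coloring of $G$ is a map $f\colon E(G)\to E(H)$ which is a proper edge-coloring (adjacent edges of $G$ receive distinct edges of $H$) such that for every vertex $x$ of $G$ there is a vertex $y$ of $H$ with $f(\partial_G(x))=\partial_H(y)$; the paper writes $H\prec G$ when $G$ admits an $H$-coloring, so the hypothesis is $G\prec S$. The Sylvester graph $S$ is the cubic multigraph on 10 vertices and 15 edges consisting of a central vertex $c$ and three disjoint blocks $\{w_i,x_i,y_i\}$, $i=1,2,3$, where $c$ is joined to each $w_i$ by a single edge (a bridge), $w_i$ is joined to $x_i$ and to $y_i$ by single edges, and $x_i$ and $y_i$ are joined by two parallel edges. *)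

(* Defs.v *)
From mathcomp Require Import all_boot.
Set Implicit Arguments.
Unset Strict Implicit.
Unset Printing Implicit Defensive.

(* Finite loopless undirected multigraphs: edges form a type of their own, so
   parallel edges are distinct elements with the same set of ends; having
   exactly two ends excludes loops. *)
Record mgraph := MGraph {
  vertex : finType;
  edge : finType;
  ends : edge -> {set vertex};
  card_ends : forall e, #|ends e| = 2
}.

Definition incident_edges (G : mgraph) (v : vertex G) : {set edge G} :=
  [set e | v \in ends e].

Definition cubic (G : mgraph) : Prop :=
  forall v : vertex G, #|incident_edges v| = 3.

Definition adjacent (G : mgraph) : rel (vertex G) :=
  fun u v => [exists e : edge G, ends e == [set u; v]].

(* The graph with no vertices does not count as connected. *)
Definition connected (G : mgraph) : Prop :=
  0 < #|vertex G| /\ forall u v : vertex G, connect (@adjacent G) u v.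

Definition adjacent_edges (G : mgraph) : rel (edge G) :=
  fun e1 e2 => (e1 != e2) && (ends e1 :&: ends e2 != set0).

(* [is_coloring H G f]: f is an H-coloring of G. *)
Definition is_coloring (H G : mgraph) (f : edge G -> edge H) : Prop :=
  (forall e1 e2 : edge G, adjacent_edges e1 e2 -> f e1 <> f e2) /\
  (forall x : vertex G, exists y : vertex H,
     f @: incident_edges x = incident_edges y).

Definition admits_coloring (H G : mgraph) : Prop :=
  exists f : edge G -> edge H, is_coloring f.

Definition isomorphic (G H : mgraph) : Prop :=
  exists (phi : vertex G -> vertex H) (psi : edge G -> edge H),
    [/\ bijective phi, bijective psi
      & forall e : edge G, ends (psi e) = phi @: ends e].

(* The central vertex is [None]; [Some (i, k)] with k = 0, 1, 2 is the vertex
   w_i, x_i, y_i of the i-th block. *)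
Definition sylvester_vertex : finType := option ('I_3 * 'I_3).
Definition sylv_c : sylvester_vertex := None.
Definition sylv_w (i : 'I_3) : sylvester_vertex := Some (i, @Ordinal 3 0 isT).
Definition sylv_x (i : 'I_3) : sylvester_vertex := Some (i, @Ordinal 3 1 isT).
Definition sylv_y (i : 'I_3) : sylvester_vertex := Some (i, @Ordinal 3 2 isT).

(* The edges (i, 3) and (i, 4) are the two parallel edges of the i-th block. *)
Definition sylvester_edge : finType := ('I_3 * 'I_5)%type.
Definition sylvester_ends (e : sylvester_edge) : {set sylvester_vertex} :=
  let i := e.1 in
  match val e.2 with
  | 0 => [set sylv_c; sylv_w i]
  | 1 => [set sylv_w i; sylv_x i]
  | 2 => [set sylv_w i; sylv_y i]
  | _ => [set sylv_x i; sylv_y i]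
  end.

Lemma card_sylvester_ends (e : sylvester_edge) : #|sylvester_ends e| = 2.
Proof.
case: e => i [] [|[|[|[|[|j]]]]] //= lt5; rewrite /sylvester_ends /= cards2 //.
all: by rewrite (inj_eq Some_inj) xpair_eqE andbF.
Qed.

Definition sylvester : mgraph := MGraph card_sylvester_ends.

(* Main.v *)
Require Import Defs.
From mathcomp Require Import all_boot.
Set Implicit Arguments.
Unset Strict Implicit.
Unset Printing Implicit Defensive.

(** A G-coloring f of S sends the star of each vertex x of S onto the star of
    some vertex phi x of G.  Adjacent vertices of S have distinct images, so
    (phi, f) is a covering map of graphs.  In G, the image of each bridge of S
    is the only edge leaving the image of its block, so it does not lie on the
    image of any triangle w_i x_i y_i; hence no vertex other than c is sent to
    phi c.  A covering of a connected graph with a one-point fiber is an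
    isomorphism. *)

Lemma ends_eq (G : mgraph) (e : edge G) (u v : vertex G) :
  u != v -> u \in ends e -> v \in ends e -> ends e = [set u; v].
Proof.
move=> uv ue ve; apply/esym/eqP; rewrite eqEcard cards2 uv card_ends leqnn andbT.
by apply/subsetP=> z; rewrite !inE => /orP[] /eqP->.
Qed.

Lemma coloring_inj_incident (H G : mgraph) (f : edge G -> edge H) (x : vertex G) :
  is_coloring f -> {in incident_edges x &, injective f}.
Proof.
move=> [fP _] e1 e2; rewrite !inE => x1 x2 eqf; apply/eqP/negPn/negP => ne12.
apply: (fP e1 e2) eqf; rewrite /adjacent_edges ne12 /=.
by apply/set0Pn; exists x; rewrite inE x1.
Qed.

(** * Coverings whose base is connected and has a one-point fiber *)

Section Covering.

Variables (H G : mgraph) (phi : vertex H -> vertex G) (f : edge H -> edge G).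
Hypothesis f_star : forall x, f @: incident_edges x = incident_edges (phi x).
Hypothesis f_inj : forall x, {in incident_edges x &, injective f}.
Hypothesis phi_inj : forall e, {in ends e &, injective phi}.

(** By [f_star], the image of each end of [e] is an end of [f e]. Both sides have two elements
    because [phi] separates the ends of [e], so the inclusion is an equality. *)
Lemma covering_ends e : ends (f e) = phi @: ends e.
Proof.
apply/esym/eqP; rewrite eqEcard (card_in_imset (@phi_inj e)) !card_ends leqnn andbT.
apply/subsetP=> _ /imsetP[x xe ->].
suff: f e \in incident_edges (phi x) by rewrite inE.
by rewrite -f_star; apply: imset_f; rewrite inE.
Qed.

Definition single_fiber (u : vertex G) :=
  exists2 x, phi x = u & forall x', phi x' = u -> x' = x.

(** An edge over [e] has an end over [u], which can only be [x]. So all edges over [e] meet at [x],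
    where [f] is injective. *)
Lemma single_fiber_edge e : (exists2 u, u \in ends e & single_fiber u) ->
  exists2 e0, f e0 = e & forall e', f e' = e -> e' = e0.
Proof.
move=> [u ue [x phix x_uniq]].
have: e \in incident_edges (phi x) by rewrite inE phix.
rewrite -f_star => /imsetP[e0 xe0 ->]; exists e0 => // e' fe'.
apply: (f_inj (x := x)) => //; rewrite inE.
have: phi x \in ends (f e').
  by rewrite fe' covering_ends imset_f //; rewrite inE in xe0.
by rewrite covering_ends => /imsetP[z ze']; rewrite phix => /esym/x_uniq <-.
Qed.

(** By [f_star], every vertex over [v] carries an edge over [e], which must be [e0]. Hence it is an
    end of [e0], and [phi] separates the two ends. *)
Lemma single_fiber_adjacent u v :
  adjacent u v -> single_fiber u -> single_fiber v.
Proof.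
move=> /existsP[e /eqP ends_e] Pu.
have ue : u \in ends e by rewrite ends_e !inE eqxx.
have ve : v \in ends e by rewrite ends_e !inE eqxx orbT.
have [e0 fe0 e0_uniq] := single_fiber_edge (ex_intro2 _ _ u ue Pu).
move: (ve); rewrite -{1}fe0 covering_ends => /imsetP[y ye0 vE].
exists y => // y' phiy'.
have: e \in incident_edges (phi y') by rewrite inE phiy'.
rewrite -f_star => /imsetP[e' y'e' /esym/e0_uniq e'E].
by apply: (phi_inj (e := e0)); rewrite ?phiy' // -e'E; rewrite inE in y'e'.
Qed.

(** The one-point fiber spreads from [phi c] along paths to all vertices, then to all edges. The
    isomorphism from [G] to [H] consists of the inverses of [phi] and [f]. *)
Lemma covering_iso c : connected G -> (forall x, phi x = phi c -> x = c) ->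
  isomorphic G H.
Proof.
move=> [_ Gconn] c_uniq.
have single u : single_fiber u.
  have /connectP[p + ->] := Gconn (phi c) u.
  have: single_fiber (phi c) by exists c.
  elim: p (phi c) => //= v p IHp w Pw /andP[wv]; apply: IHp.
  exact: single_fiber_adjacent wv Pw.
(* The inner term only extracts an end [u] of [e], which exists since [ends e] has two elements. *)
have single_edge e := single_fiber_edge
  (let: ex_intro u ue := card_gt0P (leq_trans (ltn0Sn 1) (eq_leq (esym (card_ends e))))
   in ex_intro2 _ _ u ue (single u)).
have [g gK g_uniq] := fin_all_exists2 single.
have [h hK h_uniq] := fin_all_exists2 single_edge.
have phiK : cancel phi g by move=> x; apply/esym/g_uniq.
have fK : cancel f h by move=> e; apply/esym/h_uniq.
exists g, h; split; [by exists phi | by exists f | move=> e].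
by rewrite -[in RHS](hK e) covering_ends -imset_comp (eq_imset _ phiK) imset_id.
Qed.

End Covering.

(** * Edges and stars of the Sylvester graph *)

Definition sylv_bridge (i : 'I_3) : edge sylvester := (i, @Ordinal 5 0 isT).
Definition sylv_wx (i : 'I_3) : edge sylvester := (i, @Ordinal 5 1 isT).
Definition sylv_wy (i : 'I_3) : edge sylvester := (i, @Ordinal 5 2 isT).
Definition sylv_xy (i : 'I_3) : edge sylvester := (i, @Ordinal 5 3 isT).
Definition sylv_xy' (i : 'I_3) : edge sylvester := (i, @Ordinal 5 4 isT).

Lemma incident_c : incident_edges (sylv_c : vertex sylvester) =
  [set sylv_bridge i | i : 'I_3].
Proof.
apply/setP=> -[j k]; rewrite inE; apply/idP/imsetP => [|[i _ [-> ->]]].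
  case: k => [[|[|[|[|[|?]]]]] ltk] //=; rewrite ?inE // => _.
  by exists j => //; congr (_, _); apply: val_inj.
by rewrite !inE.
Qed.

Lemma incident_w i : incident_edges (sylv_w i : vertex sylvester) =
  [set sylv_bridge i; sylv_wx i; sylv_wy i].
Proof.
(* Once the block and both coordinates of the edge are numerals, the two memberships compute. *)
case: i => [[|[|[|?]]] ?] //;
  by apply/setP=> -[[[|[|[|?]]] ?] [[|[|[|[|[|?]]]]] ?]] //; rewrite !inE.
Qed.

Lemma incident_x i : incident_edges (sylv_x i : vertex sylvester) =
  [set sylv_wx i; sylv_xy i; sylv_xy' i].
Proof.
case: i => [[|[|[|?]]] ?] //;
  by apply/setP=> -[[[|[|[|?]]] ?] [[|[|[|[|[|?]]]]] ?]] //; rewrite !inE.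
Qed.

Lemma incident_y i : incident_edges (sylv_y i : vertex sylvester) =
  [set sylv_wy i; sylv_xy i; sylv_xy' i].
Proof.
case: i => [[|[|[|?]]] ?] //;
  by apply/setP=> -[[[|[|[|?]]] ?] [[|[|[|[|[|?]]]]] ?]] //; rewrite !inE.
Qed.

(** * Colorings of the Sylvester graph *)

Section SylvesterColoring.

Variables (G : mgraph) (f : edge sylvester -> edge G).
Variable phi : vertex sylvester -> vertex G.
Hypothesis f_col : is_coloring f.
Hypothesis f_star : forall x, f @: incident_edges x = incident_edges (phi x).

(** Comparing edges of a single block is enough for the seven inequalities below, each obtained by
    naming a shared end. *)
Lemma col_neq x i (k1 k2 : 'I_5) : k1 != k2 ->
  x \in sylvester_ends (i, k1) -> x \in sylvester_ends (i, k2) ->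
  f (i, k1) != f (i, k2).
Proof.
move=> ne12 x1 x2; apply: contra_neq ne12 => eqf.
have inj := @coloring_inj_incident _ _ _ (x : vertex sylvester) f_col.
suff: ((i, k1) : edge sylvester) = (i, k2) by case.
by apply: inj => //; rewrite inE.
Qed.

Lemma col_wx_wy i : f (sylv_wx i) != f (sylv_wy i).
Proof. by apply: (@col_neq (sylv_w i)); rewrite // !inE eqxx ?orbT. Qed.

Lemma col_bridge_wx i : f (sylv_bridge i) != f (sylv_wx i).
Proof. by apply: (@col_neq (sylv_w i)); rewrite // !inE eqxx ?orbT. Qed.

Lemma col_bridge_wy i : f (sylv_bridge i) != f (sylv_wy i).
Proof. by apply: (@col_neq (sylv_w i)); rewrite // !inE eqxx ?orbT. Qed.

Lemma col_wx_xy i : f (sylv_wx i) != f (sylv_xy i).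
Proof. by apply: (@col_neq (sylv_x i)); rewrite // !inE eqxx ?orbT. Qed.

Lemma col_wx_xy' i : f (sylv_wx i) != f (sylv_xy' i).
Proof. by apply: (@col_neq (sylv_x i)); rewrite // !inE eqxx ?orbT. Qed.

Lemma col_wy_xy i : f (sylv_wy i) != f (sylv_xy i).
Proof. by apply: (@col_neq (sylv_y i)); rewrite // !inE eqxx ?orbT. Qed.

Lemma col_wy_xy' i : f (sylv_wy i) != f (sylv_xy' i).
Proof. by apply: (@col_neq (sylv_y i)); rewrite // !inE eqxx ?orbT. Qed.

Lemma star_phi_w i : incident_edges (phi (sylv_w i)) =
  [set f (sylv_bridge i); f (sylv_wx i); f (sylv_wy i)].
Proof. by rewrite -f_star incident_w !imsetU !imset_set1. Qed.

Lemma star_phi_x i : incident_edges (phi (sylv_x i)) =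
  [set f (sylv_wx i); f (sylv_xy i); f (sylv_xy' i)].
Proof. by rewrite -f_star incident_x !imsetU !imset_set1. Qed.

Lemma star_phi_y i : incident_edges (phi (sylv_y i)) =
  [set f (sylv_wy i); f (sylv_xy i); f (sylv_xy' i)].
Proof. by rewrite -f_star incident_y !imsetU !imset_set1. Qed.

Let star_neq (e : edge G) u v :
  e \in incident_edges u -> e \notin incident_edges v -> u != v.
Proof. by move=> eu; apply: contraNneq => <-. Qed.

(** The third side of the triangle tells the two stars apart: it meets [sylv_w i] but not
    [sylv_x i], and it is adjacent to all three edges at [sylv_x i], so its color differs from
    theirs. The next two lemmas argue alike. *)
Lemma phi_w_neq_x i : phi (sylv_w i) != phi (sylv_x i).
Proof.
apply: (star_neq (e := f (sylv_wy i))).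
  by rewrite star_phi_w !inE eqxx !orbT.
by rewrite star_phi_x !inE !negb_or eq_sym col_wx_wy col_wy_xy col_wy_xy'.
Qed.

Lemma phi_w_neq_y i : phi (sylv_w i) != phi (sylv_y i).
Proof.
apply: (star_neq (e := f (sylv_wx i))).
  by rewrite star_phi_w !inE eqxx !orbT.
by rewrite star_phi_y !inE !negb_or col_wx_wy col_wx_xy col_wx_xy'.
Qed.

Lemma phi_x_neq_y i : phi (sylv_x i) != phi (sylv_y i).
Proof.
apply: (star_neq (e := f (sylv_wx i))).
  by rewrite star_phi_x !inE eqxx.
by rewrite star_phi_y !inE !negb_or col_wx_wy col_wx_xy col_wx_xy'.
Qed.

(* Modulo 2, the stars of a block of S sum to its bridge. *)
Lemma block_parity i (e : edge G) :
  (phi (sylv_w i) \in ends e) (+) (phi (sylv_x i) \in ends e)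
    (+) (phi (sylv_y i) \in ends e) = (e == f (sylv_bridge i)).
Proof.
have inc v : (v \in ends e) = (e \in incident_edges v) by rewrite inE.
rewrite !inc star_phi_w star_phi_x star_phi_y !inE.
case: (eqVneq e (f (sylv_wx i))) => [->|_].
  rewrite (negPf (col_wx_wy i)) (negPf (col_wx_xy i)) (negPf (col_wx_xy' i)).
  by rewrite eq_sym (negPf (col_bridge_wx i)).
case: (eqVneq e (f (sylv_wy i))) => [->|_].
  rewrite (negPf (col_wy_xy i)) (negPf (col_wy_xy' i)).
  by rewrite eq_sym (negPf (col_bridge_wy i)).
by rewrite !orbF -addbA addbb addbF.
Qed.

(** The three vertices of a block have distinct images, so the images of its sides form a genuine
    triangle, and each vertex lies on an even number of sides of a triangle. *)
Lemma triangle_parity i (v : vertex G) :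
  (v \in ends (f (sylv_wx i))) (+) (v \in ends (f (sylv_wy i)))
    = (v \in ends (f (sylv_xy i))).
Proof.
have ends_f (e : edge G) x y : phi x != phi y -> e \in incident_edges (phi x) ->
    e \in incident_edges (phi y) -> ends e = [set phi x; phi y].
  by move=> neq; rewrite !inE; apply: ends_eq.
have -> : ends (f (sylv_wx i)) = [set phi (sylv_w i); phi (sylv_x i)].
  apply: ends_f; first exact: phi_w_neq_x.
    by rewrite star_phi_w !inE eqxx orbT.
  by rewrite star_phi_x !inE eqxx.
have -> : ends (f (sylv_wy i)) = [set phi (sylv_w i); phi (sylv_y i)].
  apply: ends_f; first exact: phi_w_neq_y.
    by rewrite star_phi_w !inE eqxx orbT.
  by rewrite star_phi_y !inE eqxx.
have -> : ends (f (sylv_xy i)) = [set phi (sylv_x i); phi (sylv_y i)].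
  apply: ends_f; first exact: phi_x_neq_y.
    by rewrite star_phi_x !inE eqxx orbT.
  by rewrite star_phi_y !inE eqxx orbT.
rewrite !inE; case: (eqVneq v (phi (sylv_w i))) => [->|_].
  by rewrite (negPf (phi_w_neq_x i)) (negPf (phi_w_neq_y i)).
case: (eqVneq v (phi (sylv_x i))) => [->|//].
by rewrite (negPf (phi_x_neq_y i)).
Qed.

(** This is the parity form of the fact that a cut edge lies on no cycle: the image of a bridge
    equals an even number of the three sides, which are distinct, hence none of them. *)
Lemma col_bridge_not_triangle i j :
  f (sylv_wx i) != f (sylv_bridge j) /\ f (sylv_wy i) != f (sylv_bridge j).
Proof.
have: (f (sylv_wx i) == f (sylv_bridge j)) (+) (f (sylv_wy i) == f (sylv_bridge j))
    = (f (sylv_xy i) == f (sylv_bridge j)).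
  (* Six bits remain: the incidences of the three vertices of block [j] with the images of
     [sylv_wx i] and [sylv_wy i]. Each occurs once on either side. *)
  rewrite -!block_parity -!triangle_parity.
  by do 6!case: (_ \in _).
move=> parity; split; apply/eqP => E; move: parity.
  rewrite -E eqxx ![_ == f (sylv_wx i)]eq_sym.
  by rewrite (negPf (col_wx_wy i)) (negPf (col_wx_xy i)).
rewrite -E eqxx ![_ == f (sylv_wy i)]eq_sym (negPf (col_wy_xy i)).
by rewrite eq_sym (negPf (col_wx_wy i)).
Qed.

(** The star of [phi sylv_c] consists of images of bridges, whereas the image of any block vertex is
    incident to the image of [sylv_wx i] or [sylv_wy i]. *)
Lemma phi_c_single_fiber x : phi x = phi sylv_c -> x = sylv_c.
Proof.
case: x => [[i k]|//] phix; exfalso.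
have star_c : incident_edges (phi (Some (i, k))) = [set f (sylv_bridge j) | j : 'I_3].
  by rewrite phix -f_star incident_c -imset_comp.
have [wx_in | wy_in] : f (sylv_wx i) \in incident_edges (phi (Some (i, k))) \/
    f (sylv_wy i) \in incident_edges (phi (Some (i, k))).
- case: k {phix star_c} => [[|[|[|?]]] ltk] //; rewrite (bool_irrelevance ltk isT).
  + by left; rewrite star_phi_w !inE eqxx orbT.
  + by left; rewrite star_phi_x !inE eqxx.
  + by right; rewrite star_phi_y !inE eqxx.
- move: wx_in; rewrite star_c => /imsetP[j _ E].
  by have [/eqP] := col_bridge_not_triangle i j.
- move: wy_in; rewrite star_c => /imsetP[j _ E].
  by have [_ /eqP] := col_bridge_not_triangle i j.
Qed.

(** An edge inside a block joins two vertices already separated by their stars; a bridge has the end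
    [sylv_c], which is alone in its fiber. *)
Lemma phi_inj_ends e : {in ends e &, injective phi}.
Proof.
have neq_inj u v : phi u != phi v -> ends e = [set u; v] ->
    {in ends e &, injective phi}.
  move=> /eqP neq -> a b; rewrite !inE.
  by move=> /orP[] /eqP-> /orP[] /eqP-> // /esym/neq.
case: e neq_inj => i [[|[|[|[|[|?]]]]] ltk] neq_inj //.
- apply: (neq_inj sylv_c (sylv_w i)) => //.
  by apply/eqP => /esym/phi_c_single_fiber.
- exact: (neq_inj _ _ (phi_w_neq_x i)).
- exact: (neq_inj _ _ (phi_w_neq_y i)).
- exact: (neq_inj _ _ (phi_x_neq_y i)).
- exact: (neq_inj _ _ (phi_x_neq_y i)).
Qed.

End SylvesterColoring.

Theorem theorem2 (G : mgraph) (hconn : connected G) (hcubic : cubic G)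
  (hcol : admits_coloring G sylvester) : isomorphic G sylvester.
Proof.
have [f f_col] := hcol.
have [phi f_star] := fin_all_exists f_col.2.
apply: (covering_iso f_star _ (phi_inj_ends f_col f_star) hconn).
  by move=> x; apply: coloring_inj_incident.
exact: phi_c_single_fiber f_col f_star.
Qed.
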